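(* Let $I\subseteq S=\Bbbk[x_1,\ldots,x_n]$ be a monomial ideal over a field $\Bbbk$, and let $\alpha\in\mathbb C^n$. A subset $F\subseteq\{1,\ldots,n\}$ is a maximal face (a facet) of the exponent simplicial complex $\mathrm{E}\Delta_\alpha$ of $I$ if and only if the set $(\alpha+\mathbb C^F)\cap\Lambda_I$ of lattice points is (Zariski) dense in $\alpha+\mathbb C^F$ and $F$ is maximal (under inclusion) with this property.
   Context: $\mathbb C^F\subseteq\mathbb C^n$ is the coordinate subspace of vectors whose support is contained in $F$. $\Lambda_I\subseteq\mathbb N^n\subseteq\mathbb C^n$ is the set of exponent vectors of monomials not in $I$. The distracting arrangement $V_I\subseteq\mathbb C^n$ is the Zariski closure of $\Lambda_I$ in $\mathbb C^n$; it is a finite union of translates of coordinate subspaces. For $\alpha\in\mathbb C^n$, let $Z_\alpha$ be the union of the irreducible components of $V_I$ passing through $\alpha$; the exponent simplicial complex is $\mathrm{E}\Delta_\alpha=\{F\subseteq\{1,\ldots,n\}\mid\mathbb C^F\subseteq-\alpha+Z_\alpha\}$ (the void complex, with no faces at all, if $\alpha\notin V_I$). *)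

(* Defs.v *)
From mathcomp Require Import all_boot all_order all_algebra.
From mathcomp Require Import classical_sets reals.
From mathcomp Require Import mpoly complex.

Set Implicit Arguments.
Unset Strict Implicit.
Unset Printing Implicit Defensive.

Import GRing.Theory.

Local Open Scope classical_set_scope.
Local Open Scope ring_scope.

Section MonomialIdeal.
Variables (k : fieldType) (n : nat).

(* Unlike [idealr_closed], this allows the unit ideal. *)
Definition is_ideal (I : set {mpoly k[n]}) : Prop :=
  [/\ I 0,
      forall p q, I p -> I q -> I (p + q)
    & forall p q, I q -> I (p * q)].

Definition monomial_ideal (I : set {mpoly k[n]}) : Prop :=
  exists M : set 'X_{1..n}, I = smallest is_ideal [set 'X_[m] | m in M].

End MonomialIdeal.

(* Affine space is ['rV[K]_n]; [x 0] is the coordinate function of [x]. *)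
Section Zariski.
Variables (K : fieldType) (n : nat).
Implicit Types A B V W : set 'rV[K]_n.

Definition zariski_closed V : Prop :=
  exists P : set {mpoly K[n]},
    V = [set x : 'rV[K]_n | forall p, P p -> p.@[x 0] = 0].

Definition zariski_closure A : set 'rV[K]_n := smallest zariski_closed A.

(* [A] is meant to be a subset of [B]; its closure in the subspace topology of
   [B] is [B `&` zariski_closure A]. *)
Definition zariski_dense_in B A : Prop := B `<=` zariski_closure A.

Definition zariski_irreducible W : Prop :=
  W !=set0 /\
  forall A B, zariski_closed A -> zariski_closed B ->
    W `<=` A `|` B -> W `<=` A \/ W `<=` B.

Definition irreducible_component V W : Prop :=
  [/\ W `<=` V, zariski_irreducible W
    & forall W', W' `<=` V -> zariski_irreducible W' -> W `<=` W' -> W' = W].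

Definition coordinate_subspace (F : {set 'I_n}) : set 'rV[K]_n :=
  [set v : 'rV[K]_n | forall i, v 0 i != 0 -> i \in F].

Definition translate (a : 'rV[K]_n) A : set 'rV[K]_n := [set a + x | x in A].

End Zariski.

Section ExponentComplex.
Variables (R : realType) (k : fieldType) (n : nat).
Implicit Types (I : set {mpoly k[n]}) (alpha : 'rV[complex R]_n).

Definition exponent_vector (m : 'X_{1..n}) : 'rV[complex R]_n :=
  \row_i (m i)%:R.

(* Lambda_I *)
Definition standard_exponents I : set 'rV[complex R]_n :=
  [set exponent_vector m | m in [set m | ~ I 'X_[m]]].

(* V_I *)
Definition distracting_arrangement I : set 'rV[complex R]_n :=
  zariski_closure (standard_exponents I).

(* Z_alpha *)
Definition components_through I alpha : set 'rV[complex R]_n :=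
  \bigcup_(W in [set W | irreducible_component (distracting_arrangement I) W
                         /\ W alpha]) W.

(* E Delta_alpha; when [alpha] is not in V_I, the union Z_alpha is empty, so
   there are no faces, not even the empty one. *)
Definition exponent_complex I alpha : set {set 'I_n} :=
  [set F | coordinate_subspace F `<=`
           translate (- alpha) (components_through I alpha)].

End ExponentComplex.

Definition maximal_in (n : nat) (D : set {set 'I_n}) (F : {set 'I_n}) : Prop :=
  D F /\ forall G : {set 'I_n}, D G -> F \subset G -> G = F.

(* Main.v *)
Require Import Defs.
From mathcomp Require Import all_boot all_order all_algebra.
From mathcomp Require Import boolp classical_sets reals.
From mathcomp Require Import mpoly complex.

Set Implicit Arguments.
Unset Strict Implicit.
Unset Printing Implicit Defensive.

Import Order.TTheory GRing.Theory Num.Theory.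

Local Open Scope classical_set_scope.
Local Open Scope ring_scope.

(* Lambda_I is closed under divisibility, so by Dickson's lemma it is a finite
   union of orthants b + N^G, each of which is dense in b + C^G.  Hence V_I is the
   union of these flats b + C^G, and an irreducible subset of V_I lies in one of
   them.  Applied to alpha + C^F, this shows that the faces of the exponent complex
   are the F with alpha + C^F in V_I, and that each of them is contained in a G for
   which the lattice points are dense in alpha + C^G.  As every such G is a face, the
   two families have the same maximal elements. *)

(** * Dickson's lemma and orthant decompositions of down-closed sets of monomials *)

Section Dickson.

Lemma nondecreasing_subsequence_nat (u : nat -> nat) :
  exists phi : nat -> nat, {homo phi : i j / (i < j)%N} /\
    {homo (u \o phi) : i j / (i <= j)%N}.
Proof.
have tail_min k : exists l, (k <= l)%N /\ forall j, (l <= j)%N -> (u l <= u j)%N.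
  (* Strong induction on the value [u k]: either [k] itself works, or a later index has a smaller
     value. *)
  have [v] := ubnP (u k); elim: v k => // v IHv k uk.
  have [[j [kj uj]]|no] := pselect (exists j, (k <= j)%N /\ (u j < u k)%N).
    have [l [jl lmin]] := IHv j (leq_trans uj uk).
    by exists l; split=> //; exact: leq_trans jl.
  exists k; split=> // j kj; rewrite leqNgt; apply/negP => uj.
  by apply: no; exists j.
have [next nextP] := choice tail_min.
(* Starting at [next 0] rather than [0] makes every [phi i], the first included, minimise [u] on its
   tail. *)
pose phi := fix phi i := if i is j.+1 then next (phi j).+1 else next 0%N.
have phiS i : (phi i < phi i.+1)%N by case: (nextP (phi i).+1).
have phi_min i j : (phi i <= j)%N -> (u (phi i) <= u j)%N.
  by case: i => [|i] ij; [case: (nextP 0%N) | case: (nextP (phi i).+1)] => _; apply.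
have phi_lt : {homo phi : i j / (i < j)%N} by apply: homo_ltn => //; exact: ltn_trans.
exists phi; split=> // i j; rewrite leq_eqVlt => /predU1P[-> //|ij] /=.
exact/phi_min/ltnW/phi_lt.
Qed.

(** Sequence form of Dickson's lemma: subsequences are extracted for one coordinate after another,
    and further extraction keeps the earlier coordinates nondecreasing. *)
Lemma nondecreasing_subsequence_mnm (n : nat) (u : nat -> 'X_{1..n}) :
  exists phi : nat -> nat, {homo phi : i j / (i < j)%N} /\
    forall i j, (i <= j)%N -> (u (phi i) <= u (phi j))%MM.
Proof.
suff [phi [phi_lt phiP]] : exists phi : nat -> nat,
    {homo phi : i j / (i < j)%N} /\ forall a, a \in enum 'I_n ->
      {homo (fun i => u (phi i) a) : i j / (i <= j)%N}.
  exists phi; split=> // i j ij; apply/mnm_lepP => a.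
  by apply: phiP ij; rewrite mem_enum.
elim: (enum _) => [|a s [phi [phi_lt phiP]]]; first by exists id; split.
have [psi [psi_lt psiP]] := nondecreasing_subsequence_nat (fun i => u (phi i) a).
exists (phi \o psi); split=> [i j ij|b]; first exact/phi_lt/psi_lt.
rewrite inE => /predU1P[->|bs i j ij]; first exact: psiP.
apply: (phiP _ bs).
by move: ij; rewrite leq_eqVlt => /predU1P[-> //|/psi_lt/ltnW].
Qed.

Variable n : nat.
Implicit Types (L : set 'X_{1..n}) (b m : 'X_{1..n}) (G : {set 'I_n}).

Definition down_closed L := forall m m', (m' <= m)%MM -> L m -> L m'.

Definition truncate_mnm (N : nat) m := [multinom minn (m i) N | i < n].

(** Otherwise every [N] has a counterexample [u N]. Along a nondecreasing subsequence, the first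
    term divides a truncation, lying in [L], of a later term, so it is itself in [L]. *)
Lemma down_closed_truncate L : down_closed L ->
  exists N, forall m, L (truncate_mnm N m) -> L m.
Proof.
move=> Ldown; apply: contrapT => noN.
have bad N : exists m, L (truncate_mnm N m) /\ ~ L m.
  apply: contrapT => nom; apply: noN; exists N => m LNm.
  by apply: contrapT => nLm; apply: nom; exists m.
have [u uP] := choice bad.
have [phi [phi_lt uphi]] := nondecreasing_subsequence_mnm u.
have phi_ge i : (i <= phi i)%N.
  by elim: i => // i IHi; apply: leq_ltn_trans IHi (phi_lt _ _ _).
have [_ nL0] := uP (phi 0%N); apply: nL0.
(* The degree bounds every exponent of [m], so truncating at [phi j], which is at least [j], cuts
   nothing below [m]. *)
set m := u _; set j := mdeg m.
have [Lj _] := uP (phi j); apply: Ldown Lj.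
apply/mnm_lepP => i; rewrite mnmE leq_min; apply/andP; split.
  exact/mnm_lepP/uphi.
apply: leq_trans (phi_ge j).
by rewrite /j mdegE (bigD1 i) //= leq_addr.
Qed.

Definition orthant b G : set 'X_{1..n} :=
  [set m | (b <= m)%MM /\ forall i, i \notin G -> m i = b i].

(* If membership of m only depends on the truncation of m at N, the fibres of
   the truncation are the orthants at t in the directions where t_i = N. *)
Lemma down_closed_orthants L : down_closed L ->
  exists s : seq ('X_{1..n} * {set 'I_n}),
    L = \bigcup_(c in [set` s]) orthant c.1 c.2.
Proof.
move=> Ldown; have [N LN] := down_closed_truncate Ldown.
pose mnm_of (t : {ffun 'I_n -> 'I_N.+1}) : 'X_{1..n} := [multinom val (t i) | i < n].
pose cell t := (mnm_of t, [set i | val (t i) == N]%SET).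
exists [seq cell t | t <- enum {: {ffun 'I_n -> 'I_N.+1}} & `[< L (mnm_of t) >]].
apply/seteqP; split=> m /=.
  move=> Lm; pose t := [ffun i => inord (minn (m i) N)] : {ffun 'I_n -> 'I_N.+1}.
  have tE i : val (t i) = minn (m i) N by rewrite ffunE /= inordK // ltnS geq_minr.
  exists (cell t) => /=; last first.
    split=> [|i]; first by apply/mnm_lepP => i; rewrite mnmE tE geq_minl.
    rewrite inE tE mnmE tE => /eqP mN.
    by move: mN; rewrite /minn; case: ltnP.
  apply/mapP; exists t => //; rewrite mem_filter mem_enum andbT; apply/asboolP.
  by apply: Ldown Lm; apply/mnm_lepP => i; rewrite mnmE tE geq_minl.
case=> _ /mapP[t + ->] [/= /mnm_lepP tm mt]; rewrite mem_filter => /andP[/asboolP Lt _].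
apply: LN; apply: Ldown Lt; apply/mnm_lepP => i; rewrite !mnmE.
have [iN|iN] := eqVneq (val (t i)) N; first by rewrite iN geq_minr.
by rewrite (mt i) ?inE // mnmE geq_minl.
Qed.

End Dickson.

Lemma bigcup_set_cons (T : eqType) (U : Type) (t : T) (s : seq T) (A : T -> set U) :
  \bigcup_(u in [set` t :: s]) A u = A t `|` \bigcup_(u in [set` s]) A u.
Proof.
apply/seteqP; split=> x /=.
  by case=> u /=; rewrite inE => /predU1P[->|us Aux]; [left | right; exists u].
by case=> [Atx|[u us Aux]]; [exists t | exists u] => //=; rewrite inE ?eqxx // us orbT.
Qed.

(** * Zariski topology of flats over a field of characteristic zero *)

Section Zariski.
Variables (K : numFieldType) (n : nat).
Implicit Types (A B V W : set 'rV[K]_n) (x y a v : 'rV[K]_n) (F G : {set 'I_n}).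
Implicit Types (p q : {mpoly K[n]}).

Lemma poly_nat_roots_eq0 (q : {poly K}) : (forall k : nat, q.[k%:R] = 0) -> q = 0.
Proof.
move=> q0; apply/eqP; apply: contraT => qn0.
have : (size [seq k%:R : K | k <- iota 0 (size q)] < size q)%N.
  apply: max_poly_roots => //.
    by apply/allP => _ /mapP[k _ ->]; apply/eqP.
  by rewrite map_inj_uniq ?iota_uniq // => i j /eqP; rewrite eqr_nat => /eqP.
by rewrite size_map size_iota ltnn.
Qed.

(** Restriction of [p] to the line through [x] with direction [v], as a polynomial in the
    parameter. *)
Definition line_poly x v p : {poly K} :=
  mmap polyC (fun i => (x 0 i)%:P + (v 0 i)%:P * 'X) p.

Lemma horner_line_poly x v p s : (line_poly x v p).[s] = p.@[(x + s *: v) 0].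
Proof.
rewrite /line_poly /meval /mmap horner_sum; apply: eq_bigr => m _.
rewrite hornerM hornerC /mmap1 horner_prod; congr (_ * _); apply: eq_bigr => i _.
by rewrite horner_exp !hornerE !mxE [s * _]mulrC.
Qed.

Lemma meval_line_eq0 x v p :
  (forall k : nat, p.@[(x + k%:R *: v) 0] = 0) -> forall s, p.@[(x + s *: v) 0] = 0.
Proof.
move=> p0 s; have l0 : line_poly x v p = 0.
  by apply: poly_nat_roots_eq0 => k; rewrite horner_line_poly.
by rewrite -horner_line_poly l0 horner0.
Qed.

Lemma zariski_closedU A B :
  zariski_closed A -> zariski_closed B -> zariski_closed (A `|` B).
Proof.
move=> [P ->] [Q ->]; exists [set r | exists p q, [/\ P p, Q q & r = p * q]].
apply/seteqP; split=> x /=.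
  move=> PQx _ [p [q [Pp Qq ->]]]; rewrite mevalM.
  by case: PQx => [/(_ p Pp)|/(_ q Qq)] ->; rewrite ?mul0r ?mulr0.
move=> x0; apply: contrapT => /not_orP[/existsNP[p /not_implyP[Pp px]]].
move=> /existsNP[q /not_implyP[Qq qx]].
have /eqP := x0 (p * q) (ex_intro _ p (ex_intro _ q (And3 Pp Qq erefl))).
by rewrite mevalM mulf_eq0 => /orP[] /eqP.
Qed.

Lemma zariski_closed_bigcup (T : eqType) (s : seq T) (A : T -> set 'rV[K]_n) :
  (forall t, zariski_closed (A t)) -> zariski_closed (\bigcup_(t in [set` s]) A t).
Proof.
move=> cA; elim: s => [|t s IHs].
  (* The constant 1 cuts out the empty union. *)
  exists [set 1]; rewrite set_nil bigcup_set0; apply/seteqP; split=> // x /(_ 1 erefl).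
  by rewrite rmorph1 => /eqP; rewrite oner_eq0.
by rewrite bigcup_set_cons; exact: zariski_closedU.
Qed.

Lemma zariski_irreducible_bigcup (T : eqType) (s : seq T) (A : T -> set 'rV[K]_n) W :
  (forall t, zariski_closed (A t)) -> zariski_irreducible W ->
  W `<=` \bigcup_(t in [set` s]) A t -> exists2 t, t \in s & W `<=` A t.
Proof.
move=> cA [[w Ww] Wirr]; elim: s => [|t s IHs].
  by rewrite set_nil bigcup_set0 => /(_ w Ww).
rewrite bigcup_set_cons => /Wirr[] //; first exact: zariski_closed_bigcup.
  by move=> Wt; exists t; rewrite ?mem_head.
by move=> /IHs[t' t's Wt']; exists t'; rewrite // inE t's orbT.
Qed.

Lemma mem_translate_coordinate a G x :
  translate a (coordinate_subspace G) x <-> forall i, i \notin G -> x 0 i = a 0 i.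
Proof.
split=> [[y yG <-] i iG|xa].
  have [y0|/yG] := eqVneq (y 0 i) 0; first by rewrite mxE y0 addr0.
  by rewrite (negPf iG).
exists (x - a); last by rewrite addrC subrK.
move=> i; apply: contraNT => iG.
by rewrite !mxE xa // subrr.
Qed.

Lemma translate_coordinate_self a G : translate a (coordinate_subspace G) a.
Proof. exact/mem_translate_coordinate. Qed.

Lemma translate_coordinate_eq a b G : translate b (coordinate_subspace G) a ->
  translate b (coordinate_subspace G) = translate a (coordinate_subspace G).
Proof.
move=> /mem_translate_coordinate ab; apply/seteqP.
by split=> x /mem_translate_coordinate xP; apply/mem_translate_coordinate => i iG;
   rewrite xP ?ab.
Qed.

Lemma translate_coordinate_subset a b F G :
  translate a (coordinate_subspace F) `<=` translate b (coordinate_subspace G) ->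
  F \subset G.
Proof.
move=> sub; apply/fintype.subsetP => i iF; apply: contraT => iG.
have /mem_translate_coordinate/(_ i iG) ab := sub _ (translate_coordinate_self a F).
(* A unit step from [a] in direction [i] stays in the first flat, but the second flat fixes
   coordinate [i]. *)
have /sub/mem_translate_coordinate/(_ i iG)/eqP :
    translate a (coordinate_subspace F) (a + delta_mx 0 i).
  apply/mem_translate_coordinate => j jF; rewrite !mxE.
  by have [ji|] := eqVneq j i; [rewrite ji iF in jF | rewrite andbF addr0].
by rewrite !mxE !eqxx ab -subr_eq0 addrAC subrr add0r oner_eq0.
Qed.

Lemma zariski_closed_translate_coordinate a G :
  zariski_closed (translate a (coordinate_subspace G)).
Proof.
exists [set 'X_i - (a 0 i)%:MP | i in [set i | i \notin G]].
apply/seteqP; split=> x.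
  move=> /mem_translate_coordinate xa _ [i iG <-].
  by rewrite mevalB mevalXU mevalC xa ?subrr.
move=> /= x0; apply/mem_translate_coordinate => i iG; apply/eqP.
have /eqP := x0 _ (ex_intro2 _ _ i iG erefl).
by rewrite mevalB mevalXU mevalC subr_eq0.
Qed.

(* Restricting to the line through a point outside A and a point outside B
   reduces irreducibility to the absence of zero divisors in K[X]. *)
Lemma zariski_irreducible_translate_coordinate a G :
  zariski_irreducible (translate a (coordinate_subspace G)).
Proof.
split; first by exists a; exact: translate_coordinate_self.
move=> A B [P ->] [Q ->] WAB; apply: contrapT => /not_orP[].
move=> /existsNP[x /not_implyP[Wx /existsNP[p /not_implyP[Pp px]]]].
move=> /existsNP[y /not_implyP[Wy /existsNP[q /not_implyP[Qq qy]]]].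
pose v := y - x.
have pq0 : line_poly x v p * line_poly x v q = 0.
  apply: poly_nat_roots_eq0 => k; rewrite hornerM !horner_line_poly.
  have /WAB[z0|z0] : translate a (coordinate_subspace G) (x + k%:R *: v).
  - move: Wx Wy => /mem_translate_coordinate xa /mem_translate_coordinate ya.
    apply/mem_translate_coordinate => i iG.
    by rewrite !mxE xa ?ya // subrr mulr0 addr0.
  - by rewrite z0 ?mul0r.
  - by rewrite [X in _ * X]z0 ?mulr0.
move/eqP: pq0; rewrite mulf_eq0 => /orP[] /eqP l0.
  by apply: px; have := horner_line_poly x v p 0; rewrite l0 horner0 scale0r addr0.
apply: qy; have := horner_line_poly x v q 1.
by rewrite l0 horner0 scale1r /v addrC subrK.
Qed.

Lemma zariski_closure_sub A V : zariski_closed V -> A `<=` V -> zariski_closure A `<=` V.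
Proof. by move=> cV AV x; apply. Qed.

Lemma zariski_closure_subl A B : A `<=` B -> zariski_closure A `<=` zariski_closure B.
Proof. by move=> AB x xA V [cV BV]; apply: xA; split=> //; exact: subset_trans BV. Qed.

(* Coordinates are freed one at a time: a polynomial vanishing at the natural
   points of a line vanishes on the line. *)
Lemma zariski_dense_lattice_points a G :
  translate a (coordinate_subspace G) `<=` zariski_closure
    [set x | exists m : 'I_n -> nat, forall i,
      x 0 i = a 0 i + (if i \in G then (m i)%:R else 0)].
Proof.
move=> x /mem_translate_coordinate xa V [[P ->] NV] p Pp.
(* [s] lists the coordinates already freed; those of [G] outside [s] still differ from [a] by a
   natural number. *)
suff free (s : seq 'I_n) y : (forall i, i \notin G -> y 0 i = a 0 i) ->
    (forall i, i \in G -> i \notin s -> exists m : nat, y 0 i = a 0 i + m%:R) ->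
    p.@[y 0] = 0.
  by apply: (free (enum 'I_n)) => // i _; rewrite mem_enum.
elim: s y => [|j s IHs] y ya yN.
  have {}yN i : exists m : nat, i \in G -> y 0 i = a 0 i + m%:R.
    have [iG|iG] := boolP (i \in G); last by exists 0%N.
    by have [m ym] := yN i iG isT; exists m.
  have [m mP] := choice yN.
  apply: NV p Pp; exists m => i; case: ifPn => iG; first exact: mP.
  by rewrite addr0 ya.
have [jG|jG] := boolP (j \in G); last first.
  apply: IHs => // i iG iNs; apply: yN => //; rewrite inE negb_or iNs andbT.
  by apply: contraNneq jG => <-.
(* Resetting coordinate [j] to that of [a] puts [y] on a line whose natural points fall under the
   induction hypothesis. *)
pose z : 'rV[K]_n := \row_i if i == j then a 0 i else y 0 i.
have -> : y = z + (y 0 j - a 0 j) *: delta_mx 0 j.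
  apply/rowP => i; rewrite !mxE eqxx /=.
  by have [->|] := eqVneq i j; rewrite ?mulr1 ?mulr0 ?addr0 // addrC subrK.
apply: meval_line_eq0 => k; apply: IHs => i iG.
  have ij : i != j by apply: contraNneq iG => ->.
  by rewrite !mxE (negPf ij) andbF mulr0 addr0 ya.
move=> iNs; rewrite !mxE eqxx /=; have [->|ij] := eqVneq i j.
  by exists k; rewrite mulr1.
by have [|m ->] := yN i iG; [rewrite inE negb_or ij | exists m; rewrite mulr0 addr0].
Qed.

End Zariski.

(** * Flats in the distracting arrangement and faces of the exponent complex *)

Section ExponentComplex.
Variables (R : realType) (k : fieldType) (n : nat).
Variables (I : set {mpoly k[n]}).
Hypothesis monI : monomial_ideal I.
Local Notation C := (complex R).
Implicit Types (alpha : 'rV[C]_n) (F G : {set 'I_n}) (b : 'X_{1..n}).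

Local Notation flat a G := (translate a (coordinate_subspace G)).
Local Notation exponents := (standard_exponents (R:=R) I).
Local Notation V := (distracting_arrangement (R:=R) I).

Lemma standard_monomials_down_closed : down_closed [set m | ~ I 'X_[m]].
Proof.
move=> m m' m'm /= nIm Im'; apply: nIm.
have mulI p q : I q -> I (p * q).
  case: monI => M ->; move=> Iq J [idJ MJ].
  by have [_ _ mulJ] := idJ; apply: mulJ; apply: Iq; split.
by rewrite -(submK m'm) mpolyXD; exact: mulI.
Qed.

Lemma orthant_dense b G : orthant b G `<=` [set m | ~ I 'X_[m]] ->
  zariski_dense_in (flat (exponent_vector R b) G)
    (flat (exponent_vector R b) G `&` exponents).
Proof.
move=> bGI x /zariski_dense_lattice_points; apply: zariski_closure_subl => {}x [m xE]; split.
  by apply/mem_translate_coordinate => i iG; rewrite xE (negPf iG) addr0.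
exists [multinom (b i + (if i \in G then m i else 0))%N | i < n].
  apply: bGI; split=> [|i iG]; last by rewrite mnmE (negPf iG) addn0.
  by apply/mnm_lepP => i; rewrite mnmE leq_addr.
apply/rowP => i; rewrite xE !mxE mnmE natrD.
by case: ifP.
Qed.

Lemma dense_flat_sub alpha G :
  zariski_dense_in (flat alpha G) (flat alpha G `&` exponents) -> flat alpha G `<=` V.
Proof.
by move=> dense x /dense; apply: zariski_closure_subl; exact: subIsetr.
Qed.

(** The flats spanned by the finitely many orthants are closed and cover [V], so one of them
    contains [W]. It passes through [alpha], which can therefore serve as its base point. *)
Lemma irreducible_sub_dense_flat W alpha : zariski_irreducible W -> W `<=` V -> W alpha ->
  exists2 G : {set 'I_n}, W `<=` flat alpha G &
    zariski_dense_in (flat alpha G) (flat alpha G `&` exponents).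
Proof.
move=> Wirr WV Wa.
have [s Ls] := down_closed_orthants standard_monomials_down_closed.
pose A (c : 'X_{1..n} * {set 'I_n}) := flat (exponent_vector R c.1) c.2.
have cA c : zariski_closed (A c) by exact: zariski_closed_translate_coordinate.
have VA : V `<=` \bigcup_(c in [set` s]) A c.
  apply: zariski_closure_sub; first exact: zariski_closed_bigcup.
  move=> _ [m Lm <-]; move: Lm; rewrite Ls => -[c cs [_ mc]].
  by exists c => //; apply/mem_translate_coordinate => i iG; rewrite !mxE mc.
have [c cs Wc] := zariski_irreducible_bigcup cA Wirr (subset_trans WV VA).
have AE := translate_coordinate_eq (Wc _ Wa).
exists c.2; rewrite -AE //; apply: orthant_dense.
by rewrite Ls; exact: (@bigcup_sup _ _ _ _ (fun c => orthant c.1 c.2)).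
Qed.

Lemma flat_sub_component alpha F : flat alpha F `<=` V ->
  exists2 H : {set 'I_n}, F \subset H & irreducible_component V (flat alpha H).
Proof.
move=> FV; pose P (H : {set 'I_n}) := `[< flat alpha H `<=` V >].
(* A maximal [H] gives a component: a larger irreducible subset of [V] lies in some [flat alpha G]
   inside [V], and maximality forces [G = H]. *)
have /maxset_exists[H /maxsetP[/asboolP HV Hmax] FH] : P F by apply/asboolP.
exists H => //; split=> //; first exact: zariski_irreducible_translate_coordinate.
move=> W WV Wirr HW.
have Wa : W alpha by exact/HW/translate_coordinate_self.
have [G WG /dense_flat_sub GV] := irreducible_sub_dense_flat Wirr WV Wa.
have HG := translate_coordinate_subset (subset_trans HW WG).
have GH : G = H by apply: Hmax => //; apply/asboolP.
by apply/seteqP; split=> //; rewrite -GH.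
Qed.

(** Components lie in [V]; conversely, a flat at [alpha] inside [V] extends to a single component,
    which passes through [alpha]. *)
Lemma exponent_complexE alpha F : exponent_complex I alpha F <-> flat alpha F `<=` V.
Proof.
split=> [FZ _ [x /FZ[z [W [[WV _ _] _] Wz] <-] <-]|FV x Fx].
  by apply: WV; rewrite addrA subrr add0r.
have [H FH Hcomp] := flat_sub_component FV.
exists (alpha + x); last by rewrite addrA addNr add0r.
exists (flat alpha H); first by split=> //; exact: translate_coordinate_self.
by exists x => // i /Fx; exact: (fintype.subsetP FH).
Qed.

End ExponentComplex.

(** Used with [D] the faces and [E] the sets with dense lattice points: a maximal element of [D]
    equals the element of [E] above it. *)
Lemma maximal_in_cofinal (n : nat) (D E : set {set 'I_n}) (F : {set 'I_n}) :
  E `<=` D -> (forall G, D G -> exists2 H : {set 'I_n}, G \subset H & E H) ->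
  maximal_in D F <-> maximal_in E F.
Proof.
move=> ED cof; split=> -[memF maxF].
  have [H FH EH] := cof _ memF.
  split=> [|G /ED]; last exact: maxF.
  by rewrite -(maxF H (ED H EH) FH).
split=> [|G DG FG]; first exact: ED.
have [H GH EH] := cof _ DG.
have HF := maxF H EH (fintype.subset_trans FG GH).
by apply/eqP; rewrite finset.eqEsubset FG andbT -HF.
Qed.

Theorem corollary2p9 (R : realType) (k : fieldType) (n : nat)
    (I : set {mpoly k[n]}) (alpha : 'rV[complex R]_n) (F : {set 'I_n}) :
  monomial_ideal I ->
  (maximal_in (exponent_complex I alpha) F <->
  maximal_in
    [set G | zariski_dense_in
               (translate alpha (coordinate_subspace G))
               (translate alpha (coordinate_subspace G)
                  `&` standard_exponents I)] F).
Proof.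
move=> monI; apply: maximal_in_cofinal => [G /dense_flat_sub GV|G].
  exact/exponent_complexE.
move=> /(exponent_complexE monI) GV.
(* Cofinality: the flat of a face is irreducible, so it lies in a flat at [alpha] with dense lattice
   points. *)
have Girr := zariski_irreducible_translate_coordinate alpha G.
have [H GH Hdense] := irreducible_sub_dense_flat monI Girr GV
  (translate_coordinate_self alpha G).
by exists H => //; exact: translate_coordinate_subset GH.
Qed.
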